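(* Fix $\lambda>0$ and assume $D(\lambda)>0$. Let $\xi^\star(\lambda)\in\arg\min_{\xi\in\mathbb R}R_{\mathrm{sd}}(\lambda,\xi)$ and $R^\star_{\mathrm{sd}}(\lambda):=R_{\mathrm{sd}}(\lambda,\xi^\star(\lambda))$. Then $$\xi^\star(\lambda)=-\frac{\lambda}{2}\,\frac{R'(\lambda)}{D(\lambda)},\qquad R^\star_{\mathrm{sd}}(\lambda)=R(\lambda)-\frac{\lambda^2}{4}\,\frac{(R'(\lambda))^2}{D(\lambda)},$$ where $R'$ denotes the derivative of $\lambda\mapsto R(\lambda)$. In particular, if $R'(\lambda)\neq0$, then $R^\star_{\mathrm{sd}}(\lambda)<R(\lambda)$ and $\operatorname{sign}(\xi^\star(\lambda))=-\operatorname{sign}(R'(\lambda))$.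
   Context: Let $\mathcal D=(X,y)$ be training data with $X\in\mathbb R^{n\times p}$ (rows $x_i^\top$) and $y\in\mathbb R^n$; no distributional assumption is made on $\mathcal D$, and all statements hold conditionally on $\mathcal D$ (with probability one). For $\lambda>0$ the teacher ridge predictor is $f_\lambda(x)=x^\top\arg\min_{\beta\in\mathbb R^p}\{\|y-X\beta\|_2^2/n+\lambda\|\beta\|_2^2\}$. Let $\hat y_\lambda=f_\lambda(X)=(f_\lambda(x_1),\dots,f_\lambda(x_n))^\top$. The pure-distilled predictor $f_{\mathrm{pd},\lambda}$ is the ridge predictor trained on $(X,\hat y_\lambda)$ with the same penalty $\lambda$, i.e. $f_{\mathrm{pd},\lambda}(x)=x^\top\arg\min_{\beta}\{\|\hat y_\lambda-X\beta\|_2^2/n+\lambda\|\beta\|_2^2\}$. For $\xi\in\mathbb R$ the self-distilled predictor is $$f_{\mathrm{sd},\lambda,\xi}(x)=x^\top\arg\min_{\beta\in\mathbb R^p}\{(1-\xi)\|y-X\beta\|_2^2/n+\xi\|\hat y_\lambda-X\beta\|_2^2/n+\lambda\|\beta\|_2^2\}.$$ Let $(x_0,y_0)\in\mathbb R^p\times\mathbb R$ be a test point (possibly out-of-distribution, not necessarily independent of $\mathcal D$) with $\mathbb E[y_0^2\mid\mathcal D]<\infty$ and $\mathbb E[\|x_0\|_2^2\mid\mathcal D]<\infty$. For a predictor $f$ set $R(f)=\mathbb E[(y_0-f(x_0))^2\mid\mathcal D]$, and write $R(\lambda)=R(f_\lambda)$ (a smooth function of $\lambda>0$ under these moment conditions),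 $R_{\mathrm{sd}}(\lambda,\xi)=R(f_{\mathrm{sd},\lambda,\xi})$, and $D(\lambda)=\mathbb E[(f_\lambda(x_0)-f_{\mathrm{pd},\lambda}(x_0))^2\mid\mathcal D]$. *)

(* Defs.v *)
From HB Require Import structures.
From mathcomp Require Import all_boot all_order all_algebra.
From mathcomp Require Import all_classical all_reals all_analysis.

Set Implicit Arguments.
Unset Strict Implicit.
Unset Printing Implicit Defensive.

Import Order.TTheory GRing.Theory Num.Theory.
Import numFieldNormedType.Exports.

Local Open Scope classical_set_scope.
Local Open Scope ring_scope.

Definition is_argmin (R : realType) (T : Type) (F : T -> R) (t : T) : Prop :=
  forall u, F t <= F u.

(* The default value 0 is returned only when F has no minimizer. *)
Definition argmin (R : realType) (p : nat) (F : 'cV[R]_p -> R) : 'cV[R]_p :=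
  xget 0 [set b | is_argmin F b].

(* The library norm on matrices is the sup norm, hence this definition of the
   squared Euclidean norm. *)
Definition sqnorm2 (R : realType) (m : nat) (v : 'cV[R]_m) : R :=
  \sum_i v i 0 ^+ 2.

Section Predictors.
Context {R : realType} {n p : nat}.
Implicit Types (X : 'M[R]_(n, p)) (y : 'cV[R]_n) (lambda xi : R).

Definition linpred (b : 'cV[R]_p) : 'cV[R]_p -> R :=
  fun x => (x^T *m b) 0 0.

Definition ridge X y lambda : 'cV[R]_p -> R :=
  linpred (argmin (fun b =>
    sqnorm2 (y - X *m b) / n%:R + lambda * sqnorm2 b)).

Definition fitted X (f : 'cV[R]_p -> R) : 'cV[R]_n :=
  \col_i f (row i X)^T.

Definition pure_distilled X y lambda : 'cV[R]_p -> R :=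
  ridge X (fitted X (ridge X y lambda)) lambda.

Definition self_distilled X y lambda xi : 'cV[R]_p -> R :=
  let yhat := fitted X (ridge X y lambda) in
  linpred (argmin (fun b =>
    (1 - xi) * (sqnorm2 (y - X *m b) / n%:R)
    + xi * (sqnorm2 (yhat - X *m b) / n%:R)
    + lambda * sqnorm2 b)).

End Predictors.

(* The sample spaces are built from tuples, which carry the Borel (product)
   sigma-algebra that matrices lack. A training sample is (rows of X, y) and a
   test point is (x0, y0). *)
Notation train_space R n p := (n.-tuple (p.-tuple R) * n.-tuple R)%type.
Notation test_space R p := (p.-tuple R * R)%type.

Definition design (R : realType) (n p : nat) (d : train_space R n p) :
    'M[R]_(n, p) := \matrix_(i, j) tnth (tnth d.1 i) j.

Definition response (R : realType) (n p : nat) (d : train_space R n p) :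
    'cV[R]_n := \col_i tnth d.2 i.

Definition covariate (R : realType) (p : nat) (z : test_space R p) :
    'cV[R]_p := \col_j tnth z.1 j.

(* kappa is a regular conditional distribution of Z given D: for all measurable
   A and B, P(D \in A, Z \in B) = E[kappa(D, B); D \in A]. With it,
   E[g(D, Z) | D] is the function of D given by \int g(D, z) kappa(D, dz). *)
Definition is_cond_law (R : realType) (d d1 d2 : measure_display)
    (Omega : measurableType d) (S : measurableType d1) (T : measurableType d2)
    (P : probability Omega R) (D : Omega -> S) (Z : Omega -> T)
    (kappa : R.-pker S ~> T) : Prop :=
  forall (A : set S) (B : set T), measurable A -> measurable B ->
    P (D @^-1` A `&` Z @^-1` B)
    = (\int[P]_(w in D @^-1` A) kappa (D w) B)%E.

(* In this section mu is the conditional law of the test point given the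
   training sample (X, y). *)
Section Risks.
Context {R : realType} {n p : nat}.
Variable mu : {measure set (test_space R p) -> \bar R}.
Implicit Types (X : 'M[R]_(n, p)) (y : 'cV[R]_n) (lambda xi : R).

Definition finite_second_moments : Prop :=
  (\int[mu]_z ((z.2 ^+ 2)%:E) < +oo)%E /\
  (\int[mu]_z ((sqnorm2 (covariate z))%:E) < +oo)%E.

Definition risk (f : 'cV[R]_p -> R) : R :=
  \int[mu]_(z in setT) ((z.2 - f (covariate z)) ^+ 2).

Definition risk_ridge X y lambda : R := risk (ridge X y lambda).

Definition risk_sd X y lambda xi : R := risk (self_distilled X y lambda xi).

Definition distill_gap X y lambda : R :=
  \int[mu]_(z in setT)
    ((ridge X y lambda (covariate z)
      - pure_distilled X y lambda (covariate z)) ^+ 2).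

End Risks.

(* Main.v *)
Require Import Defs.
From HB Require Import structures.
From mathcomp Require Import all_boot all_order all_algebra.
From mathcomp Require Import all_classical all_reals all_analysis.
From mathcomp Require Import measurable_realfun.
From mathcomp Require Import ring lra.

Set Implicit Arguments.
Unset Strict Implicit.
Unset Printing Implicit Defensive.

Import Order.TTheory GRing.Theory Num.Theory.
Import numFieldNormedType.Exports.

Local Open Scope classical_set_scope.
Local Open Scope ring_scope.

(** Fix the data and write c = 1/n, M = c X^T X + lambda I. The ridge
    coefficients are b = M^-1 (c X^T y). Two computations with M carry the
    whole argument, with w := M^-1 b.

    - Moving the penalty: since (M + h I) b = M b + h b, the coefficients at
      lambda + h are b - h (M + h I)^-1 b; hence the ridge path has velocity -w
      ([ridge_coef_shift]).
    - Distilling: refitting to the fitted values X b applies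
      M^-1 (c X^T X) = I - lambda M^-1 to b, and a mixed response gives, by
      linearity of the normal equations, b - (xi lambda) w
      ([ridge_coef_refit], [self_distilled_linpred]).

    So self-distillation with weight xi moves the predictor along the tangent
    line of the ridge path, by the signed length xi lambda. The risk is
    quadratic along lines: with Q the risk of a coefficient vector,
    Q (b - t w) = Q b + t s + t^2 S, where S = E (x0^T w)^2 and
    s = 2 E ((y0 - x0^T b) (x0^T w)) ([risk_linB]). The slope s is exactly the
    derivative of the ridge risk in lambda ([is_derive_risk_ridge]), and
    lambda^2 S is the gap D between teacher and pure-distilled predictors.
    Putting t = xi lambda gives the parabola
    R_sd(xi) = R + xi lambda R' + xi^2 D, whose vertex is the claim
    ([is_argmin_quadratic]).

    The derivative is obtained without any calculus on matrices: the exact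
    formula for the shifted coefficients leaves a remainder of order h^2, with
    a constant controlled because M + h I is bounded below by
    lambda / 2 for small h. The argument is valid for each realization of the
    training sample and for any conditional law with finite second
    moments. *)

(** * The Euclidean inner product *)

(** [linpred b x] is the inner product of [b] and [x]; the lemmas of this
    part let it serve both as the predictor and as the scalar product in the
    optimality conditions. *)

Section EuclideanProduct.
Context {R : realType}.

Lemma linpredDl (p : nat) (b c x : 'cV[R]_p) :
  linpred (b + c) x = linpred b x + linpred c x.
Proof. by rewrite /linpred mulmxDr mxE. Qed.

Lemma linpredZl (p : nat) (t : R) (b x : 'cV[R]_p) :
  linpred (t *: b) x = t * linpred b x.
Proof. by rewrite /linpred -scalemxAr mxE. Qed.

Lemma linpredBl (p : nat) (b c x : 'cV[R]_p) :
  linpred (b - c) x = linpred b x - linpred c x.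
Proof. by rewrite linpredDl -scaleN1r linpredZl mulN1r. Qed.

Lemma linpredC (p : nat) (b x : 'cV[R]_p) : linpred b x = linpred x b.
Proof. by rewrite /linpred -[in LHS](trmxK b) -trmx_mul mxE. Qed.

Lemma linpred_mulmxl (m p : nat) (A : 'M[R]_(m, p)) (v : 'cV[R]_p)
    (u : 'cV[R]_m) : linpred (A *m v) u = linpred v (A^T *m u).
Proof. by rewrite /linpred trmx_mul trmxK mulmxA. Qed.

Lemma linpredE (p : nat) (b x : 'cV[R]_p) :
  linpred b x = \sum_j x j 0 * b j 0.
Proof. by rewrite /linpred mxE; apply: eq_bigr => j _; rewrite mxE. Qed.

Lemma sqnorm2E (p : nat) (v : 'cV[R]_p) : sqnorm2 v = linpred v v.
Proof. by rewrite linpredE; apply: eq_bigr => j _; rewrite expr2. Qed.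

Lemma sqnorm2_ge0 (p : nat) (v : 'cV[R]_p) : 0 <= sqnorm2 v.
Proof. by apply: sumr_ge0 => j _; apply: sqr_ge0. Qed.

Lemma sqnorm2_le0 (p : nat) (v : 'cV[R]_p) : sqnorm2 v <= 0 -> v = 0.
Proof.
move=> v0; have /eqP : sqnorm2 v = 0 by apply/le_anti; rewrite v0 sqnorm2_ge0.
rewrite psumr_eq0 => [/allP v_eq0|j _]; last exact: sqr_ge0.
apply/colP => j; rewrite mxE.
by have /(_ (mem_index_enum j)) := v_eq0 j; rewrite sqrf_eq0 => /eqP.
Qed.

Lemma sqnorm2_linB (p : nat) (u v : 'cV[R]_p) (t : R) :
  sqnorm2 (u - t *: v) = sqnorm2 u - t * (2 * linpred v u) + t ^+ 2 * sqnorm2 v.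
Proof.
rewrite !sqnorm2E linpredBl linpredZl ![linpred _ (u - _)]linpredC.
by rewrite !linpredBl !linpredZl [linpred u v]linpredC; ring.
Qed.

(** Cauchy-Schwarz, from the nonnegativity of the squared distance of [x] to
    its projection on the line of [b]. *)
Lemma linpred_sqr_le (p : nat) (b x : 'cV[R]_p) :
  linpred b x ^+ 2 <= sqnorm2 b * sqnorm2 x.
Proof.
have [b0|b_gt0] := leP (sqnorm2 b) 0.
  rewrite (sqnorm2_le0 b0) -(scale0r (0 : 'cV_p)) linpredZl mul0r expr0n/=.
  by rewrite mulr_ge0 ?sqnorm2_ge0.
have := sqnorm2_ge0 (x - (linpred b x / sqnorm2 b) *: b).
rewrite sqnorm2_linB => h.
have := mulr_ge0 (ltW b_gt0) h.
have nb : sqnorm2 b != 0 by rewrite gt_eqF.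
suff -> : sqnorm2 b * (sqnorm2 x - linpred b x / sqnorm2 b * (2 * linpred b x)
   + (linpred b x / sqnorm2 b) ^+ 2 * sqnorm2 b)
   = sqnorm2 b * sqnorm2 x - linpred b x ^+ 2 by rewrite subr_ge0.
by field.
Qed.

End EuclideanProduct.

(** * Closed form of the estimators *)

Section RidgeCoefficients.
Context {R : realType} {n p : nat}.
Implicit Types (X : 'M[R]_(n, p)) (y : 'cV[R]_n) (lambda xi : R).

(** For [n = 0] the factor [n%:R^-1] is 0, which agrees with the division by
    [n%:R] in the objectives, so no case distinction arises. *)
Definition reg_gram X lambda : 'M[R]_p :=
  n%:R^-1 *: (X^T *m X) + lambda%:M.

Definition ridge_coef X y lambda : 'cV[R]_p :=
  invmx (reg_gram X lambda) *m (n%:R^-1 *: (X^T *m y)).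

Lemma reg_gramE X lambda (v : 'cV[R]_p) :
  reg_gram X lambda *m v = n%:R^-1 *: (X^T *m (X *m v)) + lambda *: v.
Proof. by rewrite mulmxDl -scalemxAl mulmxA mul_scalar_mx. Qed.

Lemma linpred_reg_gram X lambda (v : 'cV[R]_p) :
  linpred (reg_gram X lambda *m v) v
  = n%:R^-1 * sqnorm2 (X *m v) + lambda * sqnorm2 v.
Proof.
by rewrite reg_gramE linpredDl !linpredZl linpred_mulmxl trmxK -!sqnorm2E.
Qed.

(** The data term is a square, so the penalty alone bounds the quadratic form
    from below; invertibility and the resolvent bound both follow. *)
Lemma reg_gram_coercive X lambda (v : 'cV[R]_p) :
  lambda * sqnorm2 v <= linpred (reg_gram X lambda *m v) v.
Proof.
by rewrite linpred_reg_gram lerDr mulr_ge0 ?invr_ge0 ?ler0n ?sqnorm2_ge0.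
Qed.

Lemma reg_gram_unit X lambda : 0 < lambda -> reg_gram X lambda \in unitmx.
Proof.
move=> l0; rewrite -unitmx_tr -row_free_unit; apply: inj_row_free => v vG.
have Gv : reg_gram X lambda *m v^T = 0.
  by rewrite -[reg_gram _ _]trmxK -trmx_mul vG trmx0.
apply: trmx_inj; rewrite trmx0; apply: sqnorm2_le0.
have := reg_gram_coercive X lambda v^T.
rewrite Gv linpredC linpredE big1 => [|j _]; last by rewrite mxE mul0r.
by rewrite pmulr_rle0.
Qed.

Lemma reg_gramK X lambda (v : 'cV[R]_p) : 0 < lambda ->
  reg_gram X lambda *m (invmx (reg_gram X lambda) *m v) = v.
Proof. by move=> /(reg_gram_unit X) ?; rewrite mulKVmx. Qed.

Lemma normal_equations X y lambda : 0 < lambda ->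
  reg_gram X lambda *m ridge_coef X y lambda = n%:R^-1 *: (X^T *m y).
Proof. exact: reg_gramK. Qed.

Lemma reg_gram_inj X lambda (u v : 'cV[R]_p) : 0 < lambda ->
  reg_gram X lambda *m u = reg_gram X lambda *m v -> u = v.
Proof.
move=> /(reg_gram_unit X) G e.
by rewrite -[u](mulKmx G) e mulKmx.
Qed.

(** With [u] the image of [v], coercivity gives lambda |u|^2 <= <u, v>, and
    |v - lambda u|^2 >= 0 bounds the right-hand side. *)
Lemma invmx_reg_gram_bound X lambda (v : 'cV[R]_p) : 0 < lambda ->
  sqnorm2 (invmx (reg_gram X lambda) *m v) <= sqnorm2 v / lambda ^+ 2.
Proof.
move=> l0; set u := invmx _ *m v.
have := reg_gram_coercive X lambda u; rewrite reg_gramK// => lu.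
have := sqnorm2_ge0 (v - lambda *: u); rewrite sqnorm2_linB linpredC => h.
rewrite ler_pdivlMr ?exprn_gt0//.
have := ler_wpM2l (ltW l0) lu; nra.
Qed.

(** Both fidelity terms have the same Hessian, so the weights [1 - xi] and [xi],
    of either sign, only act through the mixed response. At the solution of
    the normal equations the first-order terms cancel and the objective exceeds
    its value there by c |X v|^2 + lambda |v|^2, hence is minimal exactly there. *)
Lemma argmin_distill X (y yhat : 'cV[R]_n) lambda xi : 0 < lambda ->
  argmin (fun b =>
    (1 - xi) * (sqnorm2 (y - X *m b) / n%:R)
    + xi * (sqnorm2 (yhat - X *m b) / n%:R)
    + lambda * sqnorm2 b)
  = ridge_coef X ((1 - xi) *: y + xi *: yhat) lambda.
Proof.
move=> l0; set F := fun b => _; set b0 := ridge_coef _ _ _.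
have F_shift v : F (b0 - v) = F b0 + n%:R^-1 * sqnorm2 (X *m v)
                              + lambda * sqnorm2 v.
  (* The normal equations tested against v. *)
  have normal : (1 - xi) * (n%:R^-1 * linpred (X *m v) (y - X *m b0))
      + xi * (n%:R^-1 * linpred (X *m v) (yhat - X *m b0))
      = lambda * linpred v b0.
    have := normal_equations X ((1 - xi) *: y + xi *: yhat) l0.
    rewrite -/b0 reg_gramE.
    move=> /(congr1 (linpred^~ v)).
    rewrite !linpredDl !linpredZl ![linpred (X^T *m _) _]linpred_mulmxl trmxK.
    rewrite linpredDl !linpredZl [linpred v b0]linpredC.
    rewrite ![linpred (X *m v) (_ - _)]linpredC !linpredBl => h.
    lra.
  rewrite /F mulmxBr.
  have res (z : 'cV[R]_n) : sqnorm2 (z - (X *m b0 - X *m v))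
      = sqnorm2 (z - X *m b0) + 2 * linpred (X *m v) (z - X *m b0)
        + sqnorm2 (X *m v).
    have -> : z - (X *m b0 - X *m v) = (z - X *m b0) - (-1) *: (X *m v).
      by rewrite scaleN1r opprB opprK addrA addrAC.
    by rewrite sqnorm2_linB; ring.
  rewrite !res.
  have -> : b0 - v = b0 - 1 *: v by rewrite scale1r.
  rewrite sqnorm2_linB.
  lra.
apply: xget_unique => [u|u u_min] /=.
  have -> : u = b0 - (b0 - u) by rewrite subKr.
  rewrite F_shift -addrA lerDl.
  by rewrite addr_ge0 ?mulr_ge0 ?sqnorm2_ge0 ?invr_ge0 ?ler0n ?ltW.
apply/esym/eqP; rewrite -subr_eq0; apply/eqP/sqnorm2_le0.
rewrite -(pmulr_rle0 _ l0); have := u_min b0; have -> : u = b0 - (b0 - u) by rewrite subKr.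
rewrite F_shift -addrA gerDl subKr => le0.
apply/(le_trans _ le0).
by rewrite lerDr mulr_ge0 ?sqnorm2_ge0 ?invr_ge0 ?ler0n.
Qed.

Lemma ridge_linpred X y lambda : 0 < lambda ->
  ridge X y lambda = linpred (ridge_coef X y lambda).
Proof.
move=> l0; rewrite /ridge.
(* Ridge is distillation with weight xi = 0, whatever the second response. *)
have -> : y = (1 - 0) *: y + 0 *: y by rewrite subr0 scale1r scale0r addr0.
rewrite -argmin_distill// !subr0 scale1r scale0r addr0.
by congr (linpred (argmin _)); apply/funext => b; rewrite mul1r mul0r addr0.
Qed.

Lemma fitted_linpred X (b : 'cV[R]_p) : fitted X (linpred b) = X *m b.
Proof.
apply/colP => i; rewrite mxE linpredE mxE.
by apply: eq_bigr => j _; rewrite !mxE.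
Qed.

(** The key identity behind distillation:
    c X^T X = M - lambda I, so refitting the fitted values subtracts
    lambda M^-1 b from b; the mixture is affine in [xi]. *)
Lemma ridge_coef_refit X y lambda xi : 0 < lambda ->
  ridge_coef X ((1 - xi) *: y + xi *: (X *m ridge_coef X y lambda)) lambda
  = ridge_coef X y lambda
    - (xi * lambda) *: (invmx (reg_gram X lambda) *m ridge_coef X y lambda).
Proof.
move=> l0; apply: (reg_gram_inj (X := X) l0).
rewrite mulmxBr -scalemxAr !normal_equations// reg_gramK//.
have : n%:R^-1 *: (X^T *m (X *m ridge_coef X y lambda)) =
    n%:R^-1 *: (X^T *m y) - lambda *: ridge_coef X y lambda.
  have := reg_gramE X lambda (ridge_coef X y lambda).
  by rewrite normal_equations// => ->; rewrite addrK.
rewrite mulmxDr -!scalemxAr scalerDr ![n%:R^-1 *: (_ *: _)]scalerA.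
rewrite ![n%:R^-1 * _]mulrC -!scalerA => ->.
by rewrite scalerBr addrA -scalerDl subrK scale1r.
Qed.

(** An exact finite-difference formula for the ridge path; its leading part in
    [h] is the same vector M^-1 b as in [ridge_coef_refit]. *)
Lemma ridge_coef_shift X y lambda h : 0 < lambda -> 0 < lambda + h ->
  ridge_coef X y (lambda + h)
  = ridge_coef X y lambda
    - h *: (invmx (reg_gram X (lambda + h)) *m ridge_coef X y lambda).
Proof.
move=> l0 lh0; apply: (reg_gram_inj (X := X) lh0).
rewrite mulmxBr -scalemxAr !normal_equations// reg_gramK//.
by rewrite reg_gramE scalerDl addrA -reg_gramE normal_equations// addrK.
Qed.

(** The resolvent identity, used to replace the [h]-dependent direction in
    [ridge_coef_shift] by its limit up to a term of order [h]. *)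
Lemma invmx_reg_gram_shift X lambda h (v : 'cV[R]_p) :
  0 < lambda -> 0 < lambda + h ->
  invmx (reg_gram X (lambda + h)) *m v
  = invmx (reg_gram X lambda) *m v
    - h *: (invmx (reg_gram X (lambda + h))
            *m (invmx (reg_gram X lambda) *m v)).
Proof.
move=> l0 lh0; apply: (reg_gram_inj (X := X) lh0).
rewrite mulmxBr -scalemxAr !reg_gramK//.
by rewrite reg_gramE scalerDl addrA -reg_gramE reg_gramK// addrK.
Qed.

Lemma self_distilled_linpred X y lambda xi : 0 < lambda ->
  self_distilled X y lambda xi
  = linpred (ridge_coef X y lambda
     - (xi * lambda) *: (invmx (reg_gram X lambda) *m ridge_coef X y lambda)).
Proof.
move=> l0; rewrite /self_distilled ridge_linpred// fitted_linpred.
by rewrite argmin_distill// ridge_coef_refit.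
Qed.

Lemma pure_distilled_linpred X y lambda : 0 < lambda ->
  pure_distilled X y lambda
  = linpred (ridge_coef X y lambda
     - lambda *: (invmx (reg_gram X lambda) *m ridge_coef X y lambda)).
Proof.
move=> l0; rewrite /pure_distilled !ridge_linpred// fitted_linpred.
(* Pure distillation is the weight xi = 1. *)
have := ridge_coef_refit X y 1 l0.
by rewrite subrr scale0r add0r scale1r mul1r => ->.
Qed.

End RidgeCoefficients.

(** * Square-integrable functions *)

Section SquareIntegrable.
Context d (T : measurableType d) (R : realType).
Variable mu : {measure set T -> \bar R}.
Implicit Types f g : T -> R.

Lemma integrable_sqr_Lfun2 f : measurable_fun setT f ->
  (\int[mu]_x ((f x ^+ 2)%:E) < +oo)%E -> f \in Lfun mu 2%:E.
Proof.
move=> mf f2; rewrite inE; apply/andP; split; rewrite inE//=.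
rewrite /finite_norm unlock poweR_lty//.
apply: le_lt_trans f2; rewrite le_eqVlt; apply/orP; left; apply/eqP.
apply: eq_integral => x _; congr EFin.
by rewrite powR_mulrn// real_normK ?num_real.
Qed.

Lemma integrable_Lfun2M f g : f \in Lfun mu 2%:E -> g \in Lfun mu 2%:E ->
  mu.-integrable setT (EFin \o (fun x => f x * g x)).
Proof. by move=> f2 g2; apply/Lfun1_integrable; apply: Lfun2_mul_Lfun1. Qed.

Lemma Rintegral_sqrD f g t : f \in Lfun mu 2%:E -> g \in Lfun mu 2%:E ->
  \int[mu]_x ((f x + t * g x) ^+ 2)
  = \int[mu]_x (f x ^+ 2) + t * (2 * \int[mu]_x (f x * g x))
    + t ^+ 2 * \int[mu]_x (g x ^+ 2).
Proof.
move=> f2 g2.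
have ifg := integrable_Lfun2M f2 g2.
have iff := Lfun2_integrable_sqr f2.
have igg := Lfun2_integrable_sqr g2.
have iZ c (k : T -> R) : mu.-integrable setT (EFin \o k) ->
    mu.-integrable setT (EFin \o (fun x => c * k x)).
  by move=> ik; apply: (integrableZl measurableT c ik).
have i2 := iZ 2 _ ifg; have it2 := iZ t _ i2; have itt := iZ (t ^+ 2) _ igg.
rewrite -!RintegralZl//.
rewrite -RintegralD//.
rewrite -RintegralD//.
  by apply: eq_Rintegral => x _; ring.
exact: (integrableD measurableT iff it2).
Qed.

End SquareIntegrable.

(** * The quadratic risk *)

Section QuadraticRisk.
Context {R : realType} {p : nat}.
Variable mu : {measure set (test_space R p) -> \bar R}.
Hypothesis mu2 : finite_second_moments mu.
Implicit Types (b v w : 'cV[R]_p) (t : R).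

Lemma measurable_coord (j : 'I_p) :
  measurable_fun setT (fun z : test_space R p => covariate z j 0).
Proof.
under eq_fun do rewrite mxE.
exact: (measurableT_comp (measurable_tnth j) measurable_fst).
Qed.

Lemma measurable_linpred b :
  measurable_fun setT (fun z : test_space R p => linpred b (covariate z)).
Proof.
under eq_fun do rewrite linpredE.
apply: measurable_sum => j; apply: measurable_funM => //.
exact: measurable_coord.
Qed.

Lemma measurable_sqnorm2 :
  measurable_fun setT (fun z : test_space R p => sqnorm2 (covariate z)).
Proof.
by apply: measurable_sum => j; apply: measurable_funX; apply: measurable_coord.
Qed.

Lemma linpred_Lfun2 b : (fun z => linpred b (covariate z)) \in Lfun mu 2%:E.
Proof.
apply: integrable_sqr_Lfun2; first exact: measurable_linpred.
have mS := measurable_sqnorm2.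
apply: (@le_lt_trans _ _
    (\int[mu]_z ((sqnorm2 b)%:E * (sqnorm2 (covariate z))%:E))%E).
  apply: ge0_le_integral => //=.
  - by move=> z _; rewrite lee_fin sqr_ge0.
  - apply/measurable_EFinP; apply: measurable_funX; exact: measurable_linpred.
  - by apply: measurable_funeM; apply/measurable_EFinP.
  - by move=> z _; rewrite -EFinM lee_fin linpred_sqr_le.
rewrite ge0_integralZl_EFin ?sqnorm2_ge0//; last exact/measurable_EFinP.
  by rewrite lte_mul_pinfty ?lee_fin ?sqnorm2_ge0//; case: mu2.
by move=> z _; rewrite lee_fin sqnorm2_ge0.
Qed.

Lemma residual_Lfun2 b :
  (fun z => z.2 - linpred b (covariate z)) \in Lfun mu 2%:E.
Proof.
have y2 : (snd : test_space R p -> R) \in Lfun mu 2%:E.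
  by apply: integrable_sqr_Lfun2; [exact: measurable_snd | case: mu2].
by have := rpredB y2 (linpred_Lfun2 b); apply; rewrite lee1n.
Qed.

Definition pred_energy v : R := \int[mu]_z (linpred v (covariate z) ^+ 2).

(** The derivative of the risk at [b] in the direction [- v], the direction in
    which both the ridge path and distillation move. *)
Definition risk_slope b v : R :=
  2 * \int[mu]_z ((z.2 - linpred b (covariate z)) * linpred v (covariate z)).

Lemma risk_linB b v t :
  risk mu (linpred (b - t *: v))
  = risk mu (linpred b) + t * risk_slope b v + t ^+ 2 * pred_energy v.
Proof.
rewrite /risk /risk_slope /pred_energy.
rewrite -(Rintegral_sqrD t (residual_Lfun2 b) (linpred_Lfun2 v)).
by apply: eq_Rintegral => z _; rewrite linpredBl linpredZl; congr (_ ^+ 2); ring.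
Qed.

Lemma risk_slope_linB b v w t :
  risk_slope b (v - t *: w) = risk_slope b v - t * risk_slope b w.
Proof.
rewrite /risk_slope.
have i u := integrable_Lfun2M (residual_Lfun2 b) (linpred_Lfun2 u).
have it : mu.-integrable setT (EFin \o (fun z =>
    t * ((z.2 - linpred b (covariate z)) * linpred w (covariate z)))).
  exact: (integrableZl measurableT t (i w)).
rewrite mulrCA -mulrBr -(RintegralZl t)// -RintegralB//.
by congr (2 * _); apply: eq_Rintegral => z _; rewrite linpredBl linpredZl; ring.
Qed.

Lemma pred_energy_le v :
  pred_energy v <= sqnorm2 v * \int[mu]_z sqnorm2 (covariate z).
Proof.
have iS : mu.-integrable setT (EFin \o (fun z => sqnorm2 (covariate z))).
  apply/integrableP; split.
    by apply/measurable_EFinP; apply: measurable_sqnorm2.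
  case: mu2 => _; apply: le_lt_trans.
  rewrite le_eqVlt; apply/orP; left; apply/eqP.
  by apply: eq_integral => z _ /=; rewrite ger0_norm ?sqnorm2_ge0.
rewrite -RintegralZl//; apply: le_Rintegral => //.
- exact: Lfun2_integrable_sqr (linpred_Lfun2 v).
- exact: (integrableZl measurableT _ iS).
- by move=> z _; apply: linpred_sqr_le.
Qed.

(** The linear term of a nonnegative quadratic polynomial is dominated by the
    other two, as evaluating at 1 and -1 shows. *)
Lemma risk_slope_le b v :
  `|risk_slope b v| <= risk mu (linpred b) + pred_energy v.
Proof.
have ge0 t : 0 <= risk mu (linpred (b - t *: v)).
  by apply: Rintegral_ge0 => z _; apply: sqr_ge0.
have := ge0 1; have := ge0 (-1); rewrite !risk_linB ler_norml => h1 h2.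
by apply/andP; split; lra.
Qed.

End QuadraticRisk.

(** * Differentiating the risk in the penalty *)

Lemma is_derive_quadratic_remainder (R : realType) (f : R -> R) (a l C e : R) :
  0 < e -> (forall h, `|h| <= e -> `|f (a + h) - f a - h * l| <= C * h ^+ 2) ->
  is_derive a 1 f l.
Proof.
move=> e0 fC.
suff cv : h^-1 *: (f (h *: 1 + a) - f a) @[h --> 0^'] --> l.
  by apply: DeriveDef; [apply/cvg_ex; exists l | exact/cvg_lim].
apply/cvgrPdist_le => /= eps eps0.
have C0 : 0 <= C.
  have := le_trans (normr_ge0 _) (fC e _); rewrite ger0_norm ?(ltW e0)// lexx.
  by move=> /(_ isT); rewrite pmulr_lge0 ?exprn_gt0.
(* C + 1 rather than C, which may vanish. *)
have d0 : 0 < Num.min e (eps / (C + 1)).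
  by rewrite lt_min e0 divr_gt0// ltr_wpDl.
near=> h.
have h0 : h != 0 by near: h; exact: nbhs_dnbhs_neq.
have : `|h| <= Num.min e (eps / (C + 1)) by near: h; exact: dnbhs0_le.
rewrite le_min => /andP[he hC].
have -> : l - h^-1 *: (f (h *: 1 + a) - f a)
    = - (h^-1 * (f (a + h) - f a - h * l)).
  by rewrite /GRing.scale /= mulr1 [h + a]addrC; field.
rewrite normrN normrM normfV ler_pdivrMl ?normr_gt0//.
apply: (le_trans (fC h he)).
rewrite -real_normK ?num_real// mulrC expr2 -mulrA ler_wpM2l//.
move: hC; rewrite ler_pdivlMr ?ltr_wpDl// => hC.
by have := normr_ge0 h; nra.
Unshelve. all: by end_near. Qed.

Section RiskDerivative.
Context {R : realType} {n p : nat}.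
Variable mu : {measure set (test_space R p) -> \bar R}.
Hypothesis mu2 : finite_second_moments mu.

(** Put u = (M + h I)^-1 b and r = (M + h I)^-1 w. The direction of the shift is
    u = w - h r, so the increment of the risk is
    h s(w) + h^2 (S(u) - s(r)), where s is [risk_slope] and S is [pred_energy];
    the coefficient of h^2 stays bounded for |h| <= lambda / 2. *)
Lemma is_derive_risk_ridge (X : 'M[R]_(n, p)) (y : 'cV[R]_n) (lambda : R) :
  0 < lambda ->
  is_derive lambda 1 (risk_ridge mu X y)
    (risk_slope mu (ridge_coef X y lambda)
       (invmx (reg_gram X lambda) *m ridge_coef X y lambda)).
Proof.
move=> l0; set b := ridge_coef X y lambda; set w := invmx _ *m b.
have l20 : 0 < lambda / 2 by rewrite divr_gt0.
pose E := \int[mu]_z sqnorm2 (covariate z).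
have E0 : 0 <= E by apply: Rintegral_ge0 => z _; apply: sqnorm2_ge0.
pose K (v : 'cV[R]_p) := sqnorm2 v / (lambda / 2) ^+ 2 * E.
have resolvent_energy h v : `|h| <= lambda / 2 ->
    pred_energy mu (invmx (reg_gram X (lambda + h)) *m v) <= K v.
  rewrite ler_norml => /andP[h1 h2].
  have lh0 : 0 < lambda + h by lra.
  apply: (le_trans (pred_energy_le mu2 _)); rewrite ler_wpM2r//.
  apply: (le_trans (invmx_reg_gram_bound X v lh0)).
  rewrite ler_wpM2l ?sqnorm2_ge0// lef_pV2 ?posrE ?exprn_gt0//.
  have le_lh : lambda / 2 <= lambda + h by lra.
  by rewrite ler_pXn2r// nnegrE ltW.
apply: (@is_derive_quadratic_remainder _ _ _ _
  (risk mu (linpred b) + K w + K b) (lambda / 2)) => // h hl.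
have lh0 : 0 < lambda + h by move: hl; rewrite ler_norml => /andP[? ?]; lra.
(* Only the slope needs the resolvent identity: the energy of u already comes
   with a factor h ^+ 2. *)
rewrite /risk_ridge !ridge_linpred// ridge_coef_shift// -/b risk_linB//.
rewrite [X in risk_slope mu b X]invmx_reg_gram_shift// -/w risk_slope_linB//.
set u := invmx (reg_gram X (lambda + h)) *m b.
set r := invmx (reg_gram X (lambda + h)) *m w.
have cancel (q s s' g : R) : q + h * (s - h * s') + h ^+ 2 * g - q - h * s
    = h ^+ 2 * (g - s') by ring.
rewrite cancel.
rewrite normrM [`|h ^+ 2|]ger0_norm ?sqr_ge0// mulrC ler_wpM2r ?sqr_ge0//.
apply: (le_trans (ler_normB _ _)).
have u0 : 0 <= pred_energy mu u by apply: Rintegral_ge0 => z _; apply: sqr_ge0.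
have uK : pred_energy mu u <= K b by exact: resolvent_energy.
have rK : pred_energy mu r <= K w by exact: resolvent_energy.
have rs := risk_slope_le mu2 b r.
rewrite (ger0_norm u0) addrC; apply: lerD uK.
by apply: (le_trans rs); rewrite lerD2l.
Qed.

End RiskDerivative.

(** * Optimal mixing *)

Lemma is_argmin_quadratic (R : realType) (r a D xi : R) : 0 < D ->
  is_argmin (fun x => r + x * a + x ^+ 2 * D) xi <-> xi = - (a / (2 * D)).
Proof.
move=> D0; have D_neq0 : D != 0 by rewrite gt_eqF.
have square x : r + x * a + x ^+ 2 * D
    = r - a ^+ 2 / (4 * D) + D * (x + a / (2 * D)) ^+ 2 by field.
split=> [/(_ (- (a / (2 * D))))|-> u]; last first.
  by rewrite !square addNr expr0n /= mulr0 addr0 lerDl mulr_ge0 ?sqr_ge0 ?ltW.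
rewrite !square addNr expr0n /= mulr0 addr0 gerDl pmulr_rle0// => xi_le0.
have : (xi + a / (2 * D)) ^+ 2 == 0 by rewrite eq_le xi_le0 sqr_ge0.
by rewrite sqrf_eq0 addr_eq0 => /eqP.
Qed.

(** The statement for one fixed sample and one fixed law of the test point, to
    which the almost sure statement reduces. *)
Lemma optimal_self_distillation (R : realType) (n p : nat)
    (mu : {measure set (test_space R p) -> \bar R})
    (X : 'M[R]_(n, p)) (y : 'cV[R]_n) (lambda : R) :
  finite_second_moments mu -> 0 < lambda -> 0 < distill_gap mu X y lambda ->
  let R' := derive1 (risk_ridge mu X y) lambda in
  [/\ derivable (risk_ridge mu X y) lambda 1,
      exists xi : R, is_argmin (risk_sd mu X y lambda) xi &
      forall xi : R, is_argmin (risk_sd mu X y lambda) xi ->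
        [/\ xi = - (lambda / 2) * (R' / distill_gap mu X y lambda),
            risk_sd mu X y lambda xi
            = risk_ridge mu X y lambda
              - lambda ^+ 2 / 4 * (R' ^+ 2 / distill_gap mu X y lambda) &
            R' != 0 ->
              risk_sd mu X y lambda xi < risk_ridge mu X y lambda /\
              Num.sg xi = - Num.sg R']].
Proof.
move=> mu2 l0 gap0 R'.
set gap := distill_gap mu X y lambda in gap0 *.
pose b := ridge_coef X y lambda; pose v := invmx (reg_gram X lambda) *m b.
have dR := is_derive_risk_ridge mu2 X y l0.
have R'E : R' = risk_slope mu b v by rewrite /R' derive1E derive_val.
have gapE : gap = lambda ^+ 2 * pred_energy mu v.
  rewrite /gap /distill_gap ridge_linpred// pure_distilled_linpred// -/b -/v.
  rewrite /pred_energy -RintegralZl//; last first.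
    exact: Lfun2_integrable_sqr (linpred_Lfun2 mu2 v).
  by apply: eq_Rintegral => z _; rewrite linpredBl linpredZl; ring.
have sdE : risk_sd mu X y lambda
    = fun xi => risk_ridge mu X y lambda + xi * (lambda * R') + xi ^+ 2 * gap.
  apply/funext => xi; rewrite /risk_sd self_distilled_linpred// -/b -/v.
  by rewrite risk_linB// /risk_ridge ridge_linpred// gapE R'E; ring.
have gap_neq0 : gap != 0 by rewrite gt_eqF.
split; first exact: ex_derive.
  by rewrite sdE; exists (- (lambda * R' / (2 * gap))); apply/is_argmin_quadratic.
move=> xi; rewrite sdE => /(is_argmin_quadratic _ _ _ gap0) xiE.
have xiE' : xi = - (lambda / 2) * (R' / gap) by rewrite xiE; field.
have minE : risk_ridge mu X y lambda + xi * (lambda * R') + xi ^+ 2 * gap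
    = risk_ridge mu X y lambda - lambda ^+ 2 / 4 * (R' ^+ 2 / gap).
  by rewrite xiE'; field.
split; [exact: xiE' | exact: minE | move=> R'0; split].
  have R'2 : 0 < R' ^+ 2 by rewrite exprn_even_gt0.
  by rewrite minE gtrDl oppr_lt0 mulr_gt0// divr_gt0// exprn_gt0.
rewrite xiE' mulNr sgrN sgrM gtr0_sg ?divr_gt0// mul1r sgrM.
by rewrite [Num.sg gap^-1]gtr0_sg ?invr_gt0// mulr1.
Qed.

Theorem theorem2p2 (R : realType) (n p : nat) (d : measure_display)
  (Omega : measurableType d) (P : probability Omega R)
  (D : {RV P >-> train_space R n p}) (Z : {RV P >-> test_space R p})
  (kappa : R.-pker (train_space R n p) ~> (test_space R p))
  (kappa_law : is_cond_law P D Z kappa) :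
  {ae P, forall w : Omega,
    let X := design (D w) in
    let y := response (D w) in
    let mu := kappa (D w) in
    finite_second_moments mu ->
    forall lambda : R, 0 < lambda -> 0 < distill_gap mu X y lambda ->
    let R' := derive1 (risk_ridge mu X y) lambda in
    [/\ derivable (risk_ridge mu X y) lambda 1,
        exists xi : R, is_argmin (risk_sd mu X y lambda) xi &
        forall xi : R, is_argmin (risk_sd mu X y lambda) xi ->
          [/\ xi = - (lambda / 2) * (R' / distill_gap mu X y lambda),
              risk_sd mu X y lambda xi
              = risk_ridge mu X y lambda
                - lambda ^+ 2 / 4 * (R' ^+ 2 / distill_gap mu X y lambda) &
              R' != 0 ->
                risk_sd mu X y lambda xi < risk_ridge mu X y lambda /\
                Num.sg xi = - Num.sg R']]}.
Proof.
apply: aeW => w mu2 lambda l0 gap0.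
exact: (optimal_self_distillation mu2 l0 gap0).
Qed.
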